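(* Let $G$ be a finite group of order $|G|=\ell$ and let $2\leq q\leq e_\ell$, where $e_\ell=\min\{m: m \text{ is a prime divisor of } \ell\}$. Suppose that $X$ is a free $G$-space and $Y$ is a Hausdorff space. If the triple $(X,G;Y)$ does not satisfy the $q$-th Borsuk-Ulam property, then \[\mathrm{secat}(X\to X/G)\leq \mathrm{secat}\left(F(Y,\ell,q)\to F(Y,\ell,q)/G\right).\] Equivalently, if $\mathrm{secat}(X\to X/G)> \mathrm{secat}\left(F(Y,\ell,q)\to F(Y,\ell,q)/G\right)$, then the triple $(X,G;Y)$ satisfies the $q$-th Borsuk-Ulam property.
   Context: ''Space'' means topological space and ''map'' means continuous map. A free $G$-space is a Hausdorff space $X$ on which the finite group $G$ acts freely on the left; $X\to X/G$ denotes the quotient map (a fibration). The triple $(X,G;Y)$ satisfies the $q$-th Borsuk-Ulam property if for every map $f:X\to Y$ there exist a point $x\in X$ and distinct $u_1,\ldots,u_q\in G$ such that $f(u_1x)=\cdots=f(u_qx)$. The configuration-like space $F(Y,\ell,q)\subset Y^\ell$ (subspace topology) is the set of all $(y_1,\ldots,y_\ell)\in Y^\ell$ such that for any indices $0<i_1<\cdots<i_q\leq\ell$ at least two of $y_{i_1},\ldots,y_{i_q}$ are different. Fix an enumeration $G=\{g_1,\ldots,g_\ell\}$ and let $h:G\to\{1,\ldots,\ell\}$ be the bijection $h(g_j)=j$. The group $G$ acts on the left on $Y^\ell$ by $g(y_1,\ldots,y_\ell)=(y_{h(g^{-1}g_1)},\ldots,y_{h(g^{-1}g_\ell)})$; this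 restricts to a left action on $F(Y,\ell,q)$, which is free when $q\leq e_\ell$. For a fibration $p:E\to B$, the sectional category $\mathrm{secat}(p)$ is the minimal cardinality of an open cover of $B$ such that each element $U$ of the cover admits a local section of $p$ (a map $s:U\to E$ with $p\circ s$ equal to the inclusion $U\hookrightarrow B$); $\mathrm{secat}(p)=\infty$ if no such finite cover exists. *)

(* Defs.v *)
From HB Require Import structures.
From mathcomp Require Import all_boot all_order all_fingroup all_algebra.
From mathcomp Require Import generic_quotient.
From mathcomp Require Import all_classical all_reals all_analysis.
Set Implicit Arguments.
Unset Strict Implicit.
Unset Printing Implicit Defensive.
Import Order.TTheory GRing.Theory Num.Theory.

Local Open Scope classical_set_scope.
Local Open Scope quotient_scope.
Local Open Scope card_scope.

(* MathComp's {action gT &-> T} is a right action, hence this record. *)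
Record left_action (gT : finGroupType) (X : Type) := LeftAction {
  lact :> gT -> X -> X;
  lact1 : forall x, lact 1%g x = x;
  lactM : forall g h x, lact (g * h)%g x = lact g (lact h x)
}.

Definition free_Gspace (gT : finGroupType) (X : topologicalType)
    (a : left_action gT X) : Prop :=
  [/\ hausdorff_space X,
      forall g : gT, continuous (a g)
    & forall (g : gT) (x : X), a g x = x -> g = 1%g].

Section OrbitSpace.
Variables (gT : finGroupType) (X : topologicalType) (a : left_action gT X).

Definition orbit_rel : rel X := fun x y => `[< exists g : gT, y = a g x >].

Fact orbit_rel_refl : reflexive orbit_rel.
Proof. by move=> x; apply/asboolP; exists 1%g; rewrite lact1. Qed.

Fact orbit_rel_sym : symmetric orbit_rel.
Proof.
suff H x y : orbit_rel x y -> orbit_rel y x by move=> x y; apply/idP/idP => /H.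
move=> /asboolP[g ->]; apply/asboolP; exists g^-1%g.
by rewrite -lactM mulVg lact1.
Qed.

Fact orbit_rel_trans : transitive orbit_rel.
Proof.
move=> y x z /asboolP[g ->] /asboolP[h ->]; apply/asboolP.
by exists (h * g)%g; rewrite lactM.
Qed.

Definition orbit_equiv : equiv_rel X :=
  EquivRel orbit_rel orbit_rel_refl orbit_rel_sym orbit_rel_trans.

Definition orbit_space : topologicalType :=
  quotient_topology {eq_quot orbit_equiv}.

Definition orbit_map (x : X) : orbit_space :=
  (\pi_(quotient_topology {eq_quot orbit_equiv}) x)%qT.

End OrbitSpace.

Definition Borsuk_Ulam_property (gT : finGroupType) (X : topologicalType)
    (a : left_action gT X) (Y : topologicalType) (q : nat) : Prop :=
  forall f : X -> Y, continuous f ->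
    exists (x : X) (u : 'I_q -> gT),
      injective u /\ (forall i j : 'I_q, f (a (u i) x) = f (a (u j) x)).

(* The coercion of [U : set B] to a type carries the subspace topology. *)
Definition has_local_section (E B : topologicalType) (p : E -> B)
    (U : set B) : Prop :=
  exists s : U -> E, continuous s /\ (forall b : U, p (s b) = set_val b).

Definition sectional_cover (E B : topologicalType) (p : E -> B)
    (n : nat) : Prop :=
  exists C : set (set B),
    [/\ C #= `I_n,
        forall U, C U -> open U,
        \bigcup_(U in C) U = setT
      & forall U, C U -> has_local_section p U].

(* [\bar int] serves as an ordered type containing the naturals and +oo. *)
Definition secat (E B : topologicalType) (p : E -> B) : \bar int :=
  match pselect (exists n, `[< sectional_cover p n >]) with
  | left ex => (Posz (ex_minn ex))%:E
  | right _ => +oo%E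
  end.

(* The pair of mutually inverse bijections j |-> g_j and g_j |-> j. *)
Record enumeration (T : Type) (l : nat) := Enumeration {
  enum_elt :> 'I_l -> T;
  enum_idx : T -> 'I_l;
  enum_eltK : cancel enum_elt enum_idx;
  enum_idxK : cancel enum_idx enum_elt
}.

Definition config_set (Y : topologicalType) (l q : nat) :
    set {ptws 'I_l -> Y} :=
  [set y | forall i : 'I_q -> 'I_l, {homo i : a b / (a < b)%N} ->
    exists a b : 'I_q, y (i a) <> y (i b)].

(* [F(Y, l, q)], with the topology induced by the product topology on [Y^l]. *)
Definition config_space (Y : topologicalType) (l q : nat) : topologicalType :=
  set_type (@config_set Y l q).

Section ConfigAction.
Variables (gT : finGroupType) (l : nat) (e : enumeration gT l).
Variables (Y : topologicalType) (q : nat).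

Definition power_act (g : gT) (y : {ptws 'I_l -> Y}) : {ptws 'I_l -> Y} :=
  fun j => y (enum_idx e (g^-1 * e j)%g).

Fact power_act1 y : power_act 1%g y = y.
Proof. by apply/funext => j; rewrite /power_act invg1 mul1g enum_eltK. Qed.

Fact power_actM g h y : power_act (g * h)%g y = power_act g (power_act h y).
Proof. by apply/funext => j; rewrite /power_act enum_idxK invMg mulgA. Qed.

(* Being in [config_set] does not depend on the order of the indices. *)
Fact config_setP (y : {ptws 'I_l -> Y}) :
  config_set q y <->
  (forall i : 'I_q -> 'I_l, injective i ->
     exists a b : 'I_q, y (i a) <> y (i b)).
Proof.
split=> [Fy i injI|Fy i incI]; last first.
  apply: Fy => a b eqi; apply/val_inj.
  by case: (ltngtP a b) => // /incI; rewrite eqi ltnn.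
have szA : size (enum (codom i)) = q.
  by rewrite -cardE card_codom // card_ord.
pose A k := tnth (Tuple (introT eqP szA)) k.
have ltA : {homo A : a b / (a < b)%N}.
  move=> a b ltab; pose x0 := i a.
  rewrite /A !(tnth_nth x0) /= -(nth_map x0 0 val) ?szA //.
  rewrite -(nth_map x0 0 val) ?szA //.
  apply: (sorted_ltn_nth ltn_trans) => //; last 2 first.
  - by rewrite inE size_map szA.
  - by rewrite inE size_map szA.
  apply: (subseq_sorted ltn_trans _ (iota_ltn_sorted 0 l)).
  by rewrite -val_enum_ord map_subseq // enumT /enum_mem filter_subseq.
have [a [b neq]] := Fy A ltA.
have inA k : exists c, i c = A k.
  have /codomP[c ->] : A k \in codom i by rewrite -mem_enum mem_tnth.
  by exists c.
have [[a' ea] [b' eb]] := (inA a, inA b).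
by exists a', b'; rewrite ea eb.
Qed.

Fact power_act_config g (y : {ptws 'I_l -> Y}) :
  config_set q y -> config_set q (power_act g y).
Proof.
move=> /config_setP Fy; apply/config_setP => i injI; apply: Fy.
move=> a b /(can_inj (enum_idxK e)) /mulgI /(can_inj (enum_eltK e)).
exact: injI.
Qed.

Definition config_act (g : gT) (y : config_space Y l q) : config_space Y l q :=
  exist _ (power_act g (val y)) (mem_set (power_act_config g (set_mem (valP y)))).

Fact config_act1 y : config_act 1%g y = y.
Proof. by apply/val_inj; rewrite /= power_act1. Qed.

Fact config_actM g h y :
  config_act (g * h)%g y = config_act g (config_act h y).
Proof. by apply/val_inj; rewrite /= power_actM. Qed.

Definition config_left_action : left_action gT (config_space Y l q) :=
  LeftAction config_act1 config_actM.

End ConfigAction.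

(* Main.v *)
(**
  A map [f] violating the [q]-th Borsuk-Ulam property gives the equivariant map
  [phi : X -> F(Y, l, q)], [phi x j = f (g_j^-1 x)], hence a map
  [psi : X/G -> F/G].  A local section [s] over [U] pulls back to [psi^-1 U]:
  send an orbit [b] to the unique [x] in [b] with [phi x = s (psi b)], which is
  unique because [G] acts freely on [F].  This section is continuous because,
  near a given orbit, the other candidates [g x] have [phi (g x)] separated from
  [s (psi b)] in the Hausdorff space [F].
*)
Require Import Defs.
From mathcomp Require Import all_boot all_order all_fingroup all_algebra.
From mathcomp Require Import generic_quotient cyclic.
From mathcomp Require Import all_classical all_reals all_analysis.
Set Implicit Arguments.
Unset Strict Implicit.
Unset Printing Implicit Defensive.
Import Order.TTheory.

Local Open Scope classical_set_scope.

(** * Separating families and product topologies *)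

Lemma hausdorff_continuous_separating (I : Type) (S T : topologicalType)
    (f : I -> S -> T) :
  hausdorff_space T -> (forall i, continuous (f i)) ->
  (forall x y, (forall i, f i x = f i y) -> x = y) -> hausdorff_space S.
Proof.
(* Points without disjoint neighbourhoods in [S] have images under each [f i] without disjoint
   neighbourhoods in [T]. *)
move=> hT cf sepf x y clxy; apply: sepf => i; apply: hT => A B nA nB.
have [z [zA zB]] := clxy _ _ (cf i x A nA) (cf i y B nB).
by exists (f i z).
Qed.

Lemma continuous_ptws (I : Type) (X Y : topologicalType)
    (f : X -> {ptws I -> Y}) :
  (forall i, continuous (fun x => f x i)) -> continuous f.
Proof.
move=> cf x; apply/cvg_sup => i; move: x.
apply/(@continuousP _ (initial_topology (@^~ i))) => A [B oB <-].
by move/continuousP: (cf i) => /(_ B oB).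
Qed.

(** * Topology of the orbit map *)

Section OrbitMap.
Variables (gT : finGroupType) (X : topologicalType) (a : left_action gT X).

Lemma orbit_mapP (x y : X) :
  orbit_map a x = orbit_map a y <-> exists g, y = a g x.
Proof.
split=> [/eqmodP/asboolP//|exg]; apply/eqmodP; exact/asboolP.
Qed.

Lemma orbit_map_act g x : orbit_map a (a g x) = orbit_map a x.
Proof. by apply/esym/orbit_mapP; exists g. Qed.

Lemma orbit_mapK (b : orbit_space a) : orbit_map a (repr b) = b.
Proof. exact: reprK. Qed.

Lemma orbit_map_continuous : continuous (orbit_map a).
Proof. exact: pi_continuous. Qed.

(** The saturation of [N] is the union of its translates, each of them open. *)
Lemma orbit_map_open (N : set X) :
  (forall g, continuous (a g)) -> open N -> open (orbit_map a @` N).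
Proof.
move=> ca oN; rewrite /open/= /quotient_open.
rewrite [X in open X](_ : _ = \bigcup_g (a g @^-1` N)).
  by apply: bigcup_open => g _; move/continuousP: (ca g); apply.
apply/seteqP; split=> [x [y Ny /esym/orbit_mapP[g gxy]]|x [g _ Ngx]].
  by exists g => //=; rewrite -gxy.
by exists (a g x) => //; exact: orbit_map_act.
Qed.

End OrbitMap.

(** * Pulling local sections back along an equivariant map *)

Section EquivariantMap.
Variables (gT : finGroupType) (X Z : topologicalType).
Variables (a : left_action gT X) (b : left_action gT Z).
Hypothesis ca : forall g, continuous (a g).
Hypothesis hZ : hausdorff_space Z.
Hypothesis freeb : forall g z, b g z = z -> g = 1%g.
Variable phi : X -> Z.
Hypothesis cphi : continuous phi.
Hypothesis phiM : forall g x, phi (a g x) = b g (phi x).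

Let psi (o : orbit_space a) : orbit_space b := orbit_map b (phi (repr o)).

(** Equivariance makes [psi] independent of the representative chosen by [repr]. *)
Let psiE x : psi (orbit_map a x) = orbit_map b (phi x).
Proof.
apply/orbit_mapP; have /orbit_mapP[g xE] := orbit_mapK (orbit_map a x).
by exists g; rewrite -phiM -xE.
Qed.

Let psi_continuous : continuous psi.
Proof.
apply/quotient_continuous.
rewrite (_ : psi \o _ = orbit_map b \o phi); last exact/funext.
by move=> x; apply: continuous_comp; [exact: cphi|exact: orbit_map_continuous].
Qed.

Lemma equivariant_pullback_section (U : set (orbit_space b)) :
  has_local_section (orbit_map b) U ->
  has_local_section (orbit_map a) (psi @^-1` U).
Proof.
move=> [s [cs sK]]; set V := psi @^-1` U.
pose r (v : V) : U := exist _ (psi (val v)) (mem_set (set_mem (valP v))).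
have cr : continuous r.
  apply: continuous_comp_initial => v.
  apply: (@continuous_comp _ _ _ (set_val : V -> _) psi); last exact: psi_continuous.
  exact: initial_continuous.
(* The group element carrying [phi (repr (val v))] to [s (r v)] also moves the representative to the
   wanted point. *)
have /choice[t tP] (v : V) :
    exists x, orbit_map a x = val v /\ phi x = s (r v).
  have : orbit_map b (phi (repr (val v))) = orbit_map b (s (r v)).
    by rewrite sK -psiE orbit_mapK.
  move=> /orbit_mapP[g sE]; exists (a g (repr (val v))).
  by rewrite orbit_map_act orbit_mapK phiM -sE.
exists t; split=> [v0|v]; last by have [] := tP v.
have [t0 phi0] := tP v0.
(* By freeness [b g (s (r v0))] differs from [s (r v0)] for [g <> 1]. The pair of empty sets is only
   a default at [g = 1], as [choice] needs a value for every [g]. *)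
have sep g : exists AB : set Z * set Z, g <> 1%g ->
    [/\ nbhs (phi (a g (t v0))) AB.1, nbhs (s (r v0)) AB.2
      & AB.1 `&` AB.2 = set0].
  have [->|/eqP g1] := eqVneq g 1%g; first by exists (set0, set0).
  have : phi (a g (t v0)) != s (r v0).
    by apply/eqP; rewrite phiM phi0 => /freeb.
  have := hZ; rewrite open_hausdorff => /[apply] -[[A B]] /=.
  move=> -[A0 B0] [oA oB /eqP AB0]; exists (A, B) => _ /=.
  by split=> //; apply: open_nbhs_nbhs; split=> //; exact/set_mem.
have {sep}[AB ABP] := choice sep.
move=> N nN.
(* Finiteness of the group keeps this intersection over all [g] a neighbourhood. *)
have nW : nbhs (t v0)
    [set x | N x /\ forall g, g <> 1%g -> (AB g).1 (phi (a g x))].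
  apply: filterI => //; apply: filter_forall => g.
  have [->|/eqP g1] := eqVneq g 1%g; first exact: nearW.
  have [nA _ _] := ABP g g1.
  have cphig : continuous (phi \o a g).
    by move=> x; apply: continuous_comp; [exact: ca|exact: cphi].
  by apply: (@filterS X _ _ _ _ _ (cphig _ _ nA)) => x Ax _.
have nB : nbhs v0 [set v | forall g, g <> 1%g -> (AB g).2 (s (r v))].
  apply: (filter_forall (nbhs_filter (v0 : V))) => g.
  have [->|/eqP g1] := eqVneq g 1%g; first exact: nearW.
  have [_ nB _] := ABP g g1.
  have csr : continuous (s \o r).
    by move=> v; apply: continuous_comp; [exact: cr|exact: cs].
  by apply: (@filterS V _ _ _ _ _ (csr _ _ nB)) => v Bv _.
move: nW; rewrite nbhsE => -[W [oW W0] WP].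
have nO : nbhs v0 (set_val @^-1` (orbit_map a @` W)).
  apply: (@initial_continuous _ _ (set_val : V -> _) v0).
  apply: open_nbhs_nbhs; split; first exact: orbit_map_open.
  by exists (t v0).
rewrite /= nbhs_simpl.
apply: filterS (filterI nO nB) => v [[x Wx xv] Bv] /=.
have [tv phiv] := tP v; have [Nx Ax] := WP _ Wx.
(* Write [t v] as [a g x] with [x] in [W]. If [g <> 1], then [phi (t v)], which is [s (r v)], would
   lie in both disjoint sets of [AB g]; so [t v = x], which is in [N]. *)
have : orbit_map a x = orbit_map a (t v) by rewrite xv tv.
move=> /orbit_mapP[g tE]; have [g1|/eqP g1] := eqVneq g 1%g.
  by rewrite tE g1 lact1.
have [_ _ /seteqP[+ _]] := ABP g g1.
by move=> /(_ (phi (t v)))[]; split; [rewrite tE; exact: Ax|rewrite phiv; exact: Bv].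
Qed.

(* The pulled-back cover may have fewer members, as [sectional_cover] counts
   sets and distinct sets may have equal preimages. *)
Lemma equivariant_sectional_cover n :
  sectional_cover (orbit_map b) n ->
  exists2 m, (m <= n)%N & sectional_cover (orbit_map a) m.
Proof.
move=> [C [Cn oC coverC secC]].
have leCn : (preimage psi @` C #<= `I_n)%card.
  by rewrite -(card_le_eqr Cn) card_image_le.
have /finite_setP[m Cm] : finite_set (preimage psi @` C).
  by apply/finite_set_leP; exists n.
exists m; first by rewrite -card_le_II -(card_le_eql Cm).
exists (preimage psi @` C); split=> //.
- by move=> _ [U CU <-]; move/continuousP: psi_continuous; apply; exact: oC.
- by rewrite bigcup_image -preimage_bigcup coverC preimage_setT.
- by move=> _ [U CU <-]; apply: equivariant_pullback_section; exact: secC.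
Qed.

Lemma equivariant_secat_le : (secat (orbit_map a) <= secat (orbit_map b))%E.
Proof.
rewrite {2}/secat; case: pselect => [exb|_]; last exact: leey.
have [n /asboolP/equivariant_sectional_cover[m lemn covm] _] := ex_minnP exb.
rewrite /secat; case: pselect => [exa|[]]; last by exists m; apply/asboolP.
rewrite lee_fin lez_nat; apply: leq_trans lemn.
by case: ex_minnP => k _; apply; apply/asboolP.
Qed.

End EquivariantMap.

(** * Configuration spaces: Hausdorff property and freeness *)

Lemma config_hausdorff (Y : topologicalType) (l q : nat) :
  hausdorff_space Y -> hausdorff_space (config_space Y l q).
Proof.
move=> hY; pose p (i : 'I_l) (y : config_space Y l q) := val y i.
apply: (@hausdorff_continuous_separating _ _ _ p) => // [i|y z yz].
  move=> y; apply: (@continuous_comp _ _ _ (set_val : config_space Y l q -> _)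
    (fun z : {ptws 'I_l -> Y} => z i)); first exact: initial_continuous.
  exact: (@proj_continuous _ (fun=> Y) i).
by apply/val_inj/funext.
Qed.

Section ConfigFree.
Variables (gT : finGroupType) (l : nat) (e : enumeration gT l).
Variables (Y : topologicalType) (q : nat).

(* A fixed point of [g] is constant on the indices of the powers of [g], of
   which there are at least [pdiv l] if [g] is nontrivial. *)
Lemma config_act_free (g : gT) (y : config_space Y l q) :
  #|gT| = l -> (q <= pdiv l)%N -> config_act e g y = y -> g = 1%g.
Proof.
move=> cardG leql gy; apply/eqP; apply: contraT => g1.
(* The order of [g] is a divisor of [l] greater than 1, hence at least the smallest prime
   divisor. *)
have ltq : (q <= #[g]%g)%N.
  apply: (leq_trans leql); apply: pdiv_min_dvd; first by rewrite order_gt1.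
  by rewrite -cardG -cardsT (@order_dvdG _ [set: gT]%G) ?inE.
have yg h : val y (enum_idx e (g^-1 * h)%g) = val y (enum_idx e h).
  have /(congr1 (fun z => val z (enum_idx e h))) := gy.
  by rewrite /= /power_act enum_idxK.
have yX k : val y (enum_idx e (g ^+ k)%g) = val y (enum_idx e 1%g).
  by elim: k => [//|k <-]; rewrite -yg expgS mulKg.
have /config_setP Fy := set_mem (valP y).
have [i j|i [j]] := Fy (fun i : 'I_q => enum_idx e (g ^+ i)%g); last first.
  by rewrite !yX.
move=> /(can_inj (enum_idxK e))/eqP; rewrite eq_expg_mod_order.
by rewrite !modn_small ?(leq_trans (ltn_ord _)) // => /eqP/val_inj.
Qed.

End ConfigFree.

(** * The equivariant map built from a map without [q]-fold collisions *)

Section OrbitConfiguration.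
Variables (gT : finGroupType) (l : nat) (e : enumeration gT l).
Variables (X Y : topologicalType) (a : left_action gT X) (q : nat).
Variable f : X -> Y.
Hypothesis collision_free : forall (x : X) (u : 'I_q -> gT), injective u ->
  exists i j : 'I_q, f (a (u i) x) <> f (a (u j) x).

Let orbit_tuple (x : X) : {ptws 'I_l -> Y} := fun j => f (a (e j)^-1%g x).

Let orbit_tuple_config x : config_set q (orbit_tuple x).
Proof.
apply/config_setP => i injI; apply: (collision_free x).
by move=> j k /invg_inj/(can_inj (enum_eltK e))/injI.
Qed.

Definition orbit_config (x : X) : config_space Y l q :=
  exist _ (orbit_tuple x) (mem_set (orbit_tuple_config x)).

(** This is why [orbit_tuple] uses inverses: [(g^-1 * e j)^-1 = (e j)^-1 * g], so reindexing the
    tuple amounts to moving [x] by [g]. *)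
Lemma orbit_config_act g x :
  orbit_config (a g x) = config_left_action e Y q g (orbit_config x).
Proof.
apply/val_inj/funext => j /=.
by rewrite /power_act /orbit_tuple enum_idxK invMg invgK lactM.
Qed.

Lemma orbit_config_continuous :
  (forall g, continuous (a g)) -> continuous f -> continuous orbit_config.
Proof.
move=> ca cf; apply: continuous_comp_initial; apply: continuous_ptws => j x.
by apply: (@continuous_comp _ _ _ (a (e j)^-1%g) f); [exact: ca|exact: cf].
Qed.

End OrbitConfiguration.

Theorem theorem3p6 (gT : finGroupType) (l : nat) (e : enumeration gT l)
    (q : nat) (X : topologicalType) (a : left_action gT X)
    (Y : topologicalType) :
  #|gT| = l -> (2 <= q <= pdiv l)%N ->
  free_Gspace a -> hausdorff_space Y ->
  (~ Borsuk_Ulam_property a Y q ->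
     (secat (orbit_map a) <= secat (orbit_map (config_left_action e Y q)))%E)
  /\
  ((secat (orbit_map (config_left_action e Y q)) < secat (orbit_map a))%E ->
     Borsuk_Ulam_property a Y q).
Proof.
move=> cardG /andP[_ leql] [_ ca _] hY.
have secat_le : ~ Borsuk_Ulam_property a Y q ->
    (secat (orbit_map a) <= secat (orbit_map (config_left_action e Y q)))%E.
  move=> /existsNP[f /not_implyP[cf nBU]].
  have collision_free (x : X) (u : 'I_q -> gT) : injective u ->
      exists i j : 'I_q, f (a (u i) x) <> f (a (u j) x).
    move=> injU; apply: contrapT => eqf; apply: nBU; exists x, u; split=> //.
    by move=> i j; apply: contrapT => neqf; apply: eqf; exists i, j.
  apply: (@equivariant_secat_le _ _ _ _ _ ca (config_hausdorff hY) _
    (orbit_config e collision_free)).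
  - by move=> g y; exact: config_act_free.
  - exact: orbit_config_continuous.
  - exact: orbit_config_act.
split=> // ltsecat; apply: contrapT => /secat_le.
by rewrite leNgt ltsecat.
Qed.
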